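(* Define the substitution $\tilde\sigma$ on words over $\{a,\tilde b,\tilde c,\tilde d\}$ by $$a\mapsto a\tilde ba,\qquad \tilde b\mapsto\tilde d,\qquad \tilde c\mapsto\tilde b,\qquad \tilde d\mapsto\tilde c.$$ Then the group $\tilde G=\langle a,\tilde b,\tilde c,\tilde d\rangle<\operatorname{Aut}(\mathcal T_2)$ has the presentation with generators $a,\tilde b,\tilde c,\tilde d$ and relators $$a^2,\ \tilde b^2,\ \tilde c^2,\ \tilde d^2,\ [\tilde b,\tilde c],\ [\tilde b,\tilde d],\ [\tilde c,\tilde d],$$ together with, for all $i\ge0$, $$\tilde\sigma^i\big((a\tilde c)^4\big),\ \tilde\sigma^i\big((a\tilde d)^4\big),\ \tilde\sigma^i\big((a\tilde ca\tilde d)^2\big),\ \tilde\sigma^i\big((a\tilde b)^8\big),\ \tilde\sigma^i\big((a\tilde ba\tilde ba\tilde c)^4\big),\ \tilde\sigma^i\big((a\tilde ba\tilde ba\tilde d)^4\big),\ \tilde\sigma^i\big((a\tilde ba\tilde ba\tilde ca\tilde ba\tilde ba\tilde d)^2\big).$$ Moreover $\tilde\sigma$ induces an injective expanding endomorphism of $\tilde G$ whose image has infinite index in $\tilde G$.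
   Context: Let $\mathcal T_2=\{0,1\}^*$ be the binary rooted tree; automorphisms act on the left on finite words. For a letter $x$ let $\overline x=x+1\bmod 2$. The automorphism $a$ is given by $a(x\sigma)=\overline x\sigma$. The automorphisms $\tilde b,\tilde c,\tilde d$ are defined recursively (all fixing both vertices of the first level) by $\tilde b(0x\sigma)=0\overline x\sigma$, $\tilde b(1\sigma)=1\tilde c(\sigma)$; $\tilde c(0\sigma)=0\sigma$, $\tilde c(1\sigma)=1\tilde d(\sigma)$; $\tilde d(0\sigma)=0\sigma$, $\tilde d(1\sigma)=1\tilde b(\sigma)$. $\tilde G$ is the subgroup of $\operatorname{Aut}(\mathcal T_2)$ generated by $a,\tilde b,\tilde c,\tilde d$. Notation: $[g,h]=ghg^{-1}h^{-1}$. ''Expanding'' is understood at the level of the substitution: $\tilde\sigma$ never decreases the length of a word and strictly increases the length of every word containing the letter $a$. *)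

(* Defs.v *)
From HB Require Import structures.
From mathcomp Require Import all_boot all_classical.
Set Implicit Arguments.
Unset Strict Implicit.
Unset Printing Implicit Defensive.
Local Open Scope classical_set_scope.
Local Open Scope group_scope.

Section Subgroups.
Variable G : groupType.
Implicit Types (S H : set G) (g h : G).

Definition generated S : set G :=
  [set g | forall K : {pred G}, group_closed K ->
     (forall s, S s -> s \in K) -> g \in K].

Definition normal_closure S : set G :=
  [set g | forall N : {pred G}, group_closed N ->
     (forall x y, x \in N -> x ^ y \in N) ->
     (forall s, S s -> s \in N) -> g \in N].

Definition left_coset g H : set G := [set g * h | h in H].

Definition infinite_index H : Prop :=
  infinite_set (range (fun g => left_coset g H)).

(* MathComp's [~ g, h] is g^-1 * h^-1 * g * h *)
Definition comm g h : G := g * h * g^-1 * h^-1.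

Lemma generated_closed S : group_closed [pred g | `[< generated S g >]].
Proof.
split=> [|g h /asboolP Sg /asboolP Sh]; apply/asboolP; first by move=> K [].
by move=> K cK SK; apply: cK.2; [apply: Sg | apply: Sh].
Qed.

Lemma sub_generated S g : S g -> generated S g.
Proof. by move=> Sg K _; apply. Qed.

End Subgroups.

(* The free group on X, as reduced words: (x, false) is the letter x and *)
(* (x, true) is its formal inverse. *)

Section FreeGroup.
Variable X : choiceType.
Implicit Types (l m : X * bool) (w u v : seq (X * bool)).

Definition inv_letter l := (l.1, ~~ l.2).

Definition reduced w : bool := sorted (fun l m => m != inv_letter l) w.

Definition cons_red l w : seq (X * bool) :=
  if w is m :: w' then if m == inv_letter l then w' else l :: w
  else [:: l].

Definition reduce w : seq (X * bool) := foldr cons_red [::] w.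

Definition inv_word w : seq (X * bool) := rev (map inv_letter w).

Record freeGroup := FreeGroup { fword : seq (X * bool); _ : reduced fword }.

HB.instance Definition _ := [isSub for fword].
HB.instance Definition _ := [Choice of freeGroup by <:].

Lemma inv_letterK : involutive inv_letter.
Proof. by case=> x b; rewrite /inv_letter /= negbK. Qed.

Lemma reduced_cons l w : reduced w -> reduced (cons_red l w).
Proof.
case: w => [//|m w] /= rw; case: ifPn => [_|lm].
  by move: rw; apply: path_sorted.
by rewrite /= lm.
Qed.

Lemma reduced_reduce w : reduced (reduce w).
Proof. by elim: w => [//|l w IHw] /=; apply: reduced_cons. Qed.

Lemma reduced_foldr u w : reduced w -> reduced (foldr cons_red w u).
Proof. by move=> rw; elim: u => [//|l u IHu] /=; apply: reduced_cons. Qed.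

Lemma reduce_id w : reduced w -> reduce w = w.
Proof.
elim: w => [//|l w IHw] rw; rewrite /= IHw; last exact: path_sorted rw.
by case: w rw {IHw} => [//|m w] /= /andP[/negPf->].
Qed.

Lemma cons_redK l w : reduced w -> cons_red (inv_letter l) (cons_red l w) = w.
Proof.
case: w => [|m w] /=; first by rewrite inv_letterK eqxx.
case: ifPn => [/eqP-> | _ _]; last by rewrite /= inv_letterK eqxx.
by case: w => [//|n w] /= /andP[/negPf->].
Qed.

Lemma cons_redVK l w : reduced w -> cons_red l (cons_red (inv_letter l) w) = w.
Proof. by move=> rw; rewrite -{1}[l]inv_letterK cons_redK. Qed.

Lemma foldr_cons_red l u w : reduced w ->
  foldr cons_red w (cons_red l u) = cons_red l (foldr cons_red w u).
Proof.
move=> rw; case: u => [//|m u] /=; case: eqP => [-> | //].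
by rewrite cons_redVK // reduced_foldr.
Qed.

Lemma foldr_reduce u w : reduced w ->
  foldr cons_red w (reduce u) = foldr cons_red w u.
Proof. by move=> rw; elim: u => [//|l u IHu]; rewrite /= foldr_cons_red ?IHu. Qed.

Lemma reduce_cat u v : reduce (u ++ v) = foldr cons_red (reduce v) u.
Proof. by rewrite /reduce foldr_cat. Qed.

Lemma reduce_catl u v : reduce (reduce u ++ v) = reduce (u ++ v).
Proof. by rewrite !reduce_cat foldr_reduce // reduced_reduce. Qed.

Lemma reduce_catr u v : reduce (u ++ reduce v) = reduce (u ++ v).
Proof. by rewrite !reduce_cat reduce_id // reduced_reduce. Qed.

Lemma reduceV w : reduce (inv_word w ++ w) = [::].
Proof.
elim: w => [//|l w IHw].
rewrite /inv_word /= rev_cons -cats1 -catA reduce_cat /=.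
by rewrite cons_redK ?reduced_reduce // -reduce_cat.
Qed.

Lemma inv_wordK : involutive inv_word.
Proof. by move=> w; rewrite /inv_word map_rev revK mapK //; apply: inv_letterK. Qed.

Definition free_of_word w : freeGroup := FreeGroup (reduced_reduce w).
Definition free_one : freeGroup := free_of_word [::].
Definition free_mul (u v : freeGroup) := free_of_word (fword u ++ fword v).
Definition free_inv (u : freeGroup) := free_of_word (inv_word (fword u)).

Lemma free_mulA : associative free_mul.
Proof. by move=> u v w; apply: val_inj; rewrite /= reduce_catl reduce_catr catA. Qed.
Lemma free_mul1 : left_id free_one free_mul.
Proof. by move=> u; apply: val_inj; rewrite /= reduce_id //; apply: valP. Qed.
Lemma free_mulr1 : right_id free_one free_mul.
Proof. by move=> u; apply: val_inj; rewrite /= cats0 reduce_id //; apply: valP. Qed.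
Lemma free_mulV : left_inverse free_one free_inv free_mul.
Proof. by move=> u; apply: val_inj; rewrite /= reduce_catl reduceV. Qed.
Lemma free_mulrV : right_inverse free_one free_inv free_mul.
Proof.
move=> u; apply: val_inj; rewrite /= reduce_catr.
by rewrite -{1}[fword u]inv_wordK reduceV.
Qed.

HB.instance Definition _ := isGroup.Build freeGroup
  free_mulA free_mul1 free_mulr1 free_mulV free_mulrV.

Definition free_gen (x : X) : freeGroup := free_of_word [:: (x, false)].

Section Lift.
Variables (G : groupType) (gen : X -> G).

Definition eval_letter l : G := if l.2 then (gen l.1)^-1 else gen l.1.

Definition free_lift (u : freeGroup) : G :=
  \prod_(l <- fword u) eval_letter l.

Lemma eval_inv_letter l : eval_letter (inv_letter l) = (eval_letter l)^-1.
Proof. by case: l => x [] //=; rewrite /eval_letter /= invgK. Qed.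

Lemma eval_reduce w :
  \prod_(l <- reduce w) eval_letter l = \prod_(l <- w) eval_letter l.
Proof.
elim: w => [//|l w IHw]; rewrite big_cons -IHw /=.
case: (reduce w) => [|m v] /=; first by rewrite !big_cons.
case: eqP => [->|_]; last by rewrite big_cons.
by rewrite big_cons eval_inv_letter mulgA mulgV mul1g.
Qed.

Lemma free_lift_morphism : monoid_morphism free_lift.
Proof.
split=> [|u v]; first by rewrite /free_lift big_nil.
by rewrite /free_lift /= eval_reduce big_cat.
Qed.

HB.instance Definition _ :=
  isUMagmaMorphism.Build freeGroup G free_lift free_lift_morphism.

Lemma free_lift_gen x : free_lift (free_gen x) = gen x.
Proof. by rewrite /free_lift /= big_seq1. Qed.

End Lift.
End FreeGroup.

(* gen makes G the quotient of the free group on X by the normal closure *)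
(* of R *)
Definition is_presentation (X : choiceType) (G : groupType) (gen : X -> G)
    (R : set (freeGroup X)) : Prop :=
  (forall g : G, exists u, free_lift gen u = g) /\
  (forall u, free_lift gen u = 1 <-> normal_closure R u).

(* The binary rooted tree: vertices are the words over {0,1} (false is 0), *)
(* the root is the empty word, and v is joined to v0 and v1. *)

Notation vertex := (seq bool).

Definition adjacent (u v : vertex) : Prop :=
  exists x, v = rcons u x \/ u = rcons v x.

Definition is_tree_aut (f : vertex -> vertex) : Prop :=
  [/\ bijective f, f [::] = [::] &
      forall u v, adjacent u v <-> adjacent (f u) (f v)].

Record treeAut := TreeAut { aut_fun :> vertex -> vertex;
                            _ : `[< is_tree_aut aut_fun >] }.

HB.instance Definition _ := [isSub for aut_fun].
HB.instance Definition _ := [Choice of treeAut by <:].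

Lemma treeAutP (f : treeAut) : is_tree_aut f.
Proof. exact/asboolP/(valP f). Qed.

Lemma is_tree_aut_id : is_tree_aut id.
Proof. by split=> //; exists id. Qed.

Lemma is_tree_aut_comp f g :
  is_tree_aut f -> is_tree_aut g -> is_tree_aut (f \o g).
Proof.
case=> bf f0 af [bg g0 ag]; split; first exact: bij_comp.
  by rewrite /= g0 f0.
by move=> u v; apply: iff_trans (ag u v) (af _ _).
Qed.

Lemma is_tree_aut_cancel f g :
  cancel f g -> cancel g f -> is_tree_aut f -> is_tree_aut g.
Proof.
move=> fK gK [_ f0 af]; split; first by exists f.
  by rewrite -[in LHS]f0 fK.
by move=> u v; rewrite (af (g u)) !gK.
Qed.

Lemma aut_inv_subproof (f : treeAut) :
  {g : vertex -> vertex | cancel f g /\ cancel g f}.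
Proof. by apply: cid; have [[g fK gK] _ _] := treeAutP f; exists g. Qed.

Definition aut_inv_fun (f : treeAut) := sval (aut_inv_subproof f).

Lemma aut_funK (f : treeAut) : cancel f (aut_inv_fun f).
Proof. by rewrite /aut_inv_fun; case: aut_inv_subproof => g []. Qed.

Lemma aut_invK (f : treeAut) : cancel (aut_inv_fun f) f.
Proof. by rewrite /aut_inv_fun; case: aut_inv_subproof => g []. Qed.

Definition mk_aut f (pf : is_tree_aut f) : treeAut :=
  TreeAut (asboolT pf).

Definition aut_one : treeAut := mk_aut is_tree_aut_id.
Definition aut_mul (f g : treeAut) : treeAut :=
  mk_aut (is_tree_aut_comp (treeAutP f) (treeAutP g)).
Definition aut_inv (f : treeAut) : treeAut :=
  mk_aut (is_tree_aut_cancel (@aut_funK f) (@aut_invK f) (treeAutP f)).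

Lemma aut_mulA : associative aut_mul.
Proof. by move=> f g h; apply: val_inj. Qed.
Lemma aut_mul1 : left_id aut_one aut_mul.
Proof. by move=> f; apply: val_inj. Qed.
Lemma aut_mulr1 : right_id aut_one aut_mul.
Proof. by move=> f; apply: val_inj. Qed.
Lemma aut_mulV : left_inverse aut_one aut_inv aut_mul.
Proof. by move=> f; apply/val_inj/funext=> u; apply: aut_funK. Qed.
Lemma aut_mulrV : right_inverse aut_one aut_inv aut_mul.
Proof. by move=> f; apply/val_inj/funext=> u; apply: aut_invK. Qed.

HB.instance Definition _ := isGroup.Build treeAut
  aut_mulA aut_mul1 aut_mulr1 aut_mulV aut_mulrV.

Definition a_fun (w : vertex) : vertex :=
  if w is x :: s then ~~ x :: s else w.

Fixpoint b_fun (w : vertex) : vertex :=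
  match w with
  | false :: x :: s => false :: ~~ x :: s
  | true :: s => true :: c_fun s
  | _ => w
  end
with c_fun (w : vertex) : vertex :=
  match w with
  | true :: s => true :: d_fun s
  | _ => w
  end
with d_fun (w : vertex) : vertex :=
  match w with
  | true :: s => true :: b_fun s
  | _ => w
  end.

Lemma bcd_involutive : [/\ involutive b_fun, involutive c_fun & involutive d_fun].
Proof.
suff H w : [/\ b_fun (b_fun w) = w, c_fun (c_fun w) = w & d_fun (d_fun w) = w].
  by split=> w; case: (H w).
elim: w => [//|[] w [IHb IHc IHd]] /=; first by rewrite IHb IHc IHd.
by split=> //; case: w {IHb IHc IHd} => [//|x w] /=; rewrite negbK.
Qed.

Lemma a_involutive : involutive a_fun.
Proof. by case=> [//|x w] /=; rewrite negbK. Qed.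

Lemma a_rcons w x : exists y, a_fun (rcons w x) = rcons (a_fun w) y.
Proof. by case: w => [|y w]; [exists (~~ x) | exists x]. Qed.

Lemma bcd_rcons w x :
  [/\ exists y, b_fun (rcons w x) = rcons (b_fun w) y,
      exists y, c_fun (rcons w x) = rcons (c_fun w) y &
      exists y, d_fun (rcons w x) = rcons (d_fun w) y].
Proof.
elim: w => [|[] w [[y yb] [z zc] [t td]]] /=.
- by case: x; split; by [exists true | exists false].
- by split; [exists z; rewrite zc | exists t; rewrite td | exists y; rewrite yb].
split; try by exists x.
by case: w {yb zc td} => [|u w] /=; [exists (~~ x) | exists x].
Qed.

Lemma is_tree_aut_involution f : involutive f -> f [::] = [::] ->
  (forall w x, exists y, f (rcons w x) = rcons (f w) y) -> is_tree_aut f.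
Proof.
move=> fK f0 fr; split=> //; first exact: inv_bij.
have af u v : adjacent u v -> adjacent (f u) (f v).
  by case=> x [] ->; [have [y ->] := fr u x | have [y ->] := fr v x];
     exists y; [left | right].
by move=> u v; split=> [/af //|/af]; rewrite !fK.
Qed.

Lemma a_aut : is_tree_aut a_fun.
Proof. exact: is_tree_aut_involution a_involutive _ a_rcons. Qed.

Lemma b_aut : is_tree_aut b_fun.
Proof.
have [bK _ _] := bcd_involutive.
by apply: is_tree_aut_involution => // w x; case: (bcd_rcons w x).
Qed.

Lemma c_aut : is_tree_aut c_fun.
Proof.
have [_ cK _] := bcd_involutive.
by apply: is_tree_aut_involution => // w x; case: (bcd_rcons w x).
Qed.

Lemma d_aut : is_tree_aut d_fun.
Proof.
have [_ _ dK] := bcd_involutive.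
by apply: is_tree_aut_involution => // w x; case: (bcd_rcons w x).
Qed.

Inductive letter := La | Lb | Lc | Ld.

Definition nat_of_letter (l : letter) : nat :=
  match l with La => 0 | Lb => 1 | Lc => 2 | Ld => 3 end.
Definition letter_of_nat (n : nat) : letter :=
  match n with 0 => La | 1 => Lb | 2 => Lc | _ => Ld end.
Lemma nat_of_letterK : cancel nat_of_letter letter_of_nat.
Proof. by case. Qed.
HB.instance Definition _ := Countable.copy letter (can_type nat_of_letterK).

Definition aut_gen (l : letter) : treeAut :=
  match l with
  | La => mk_aut a_aut
  | Lb => mk_aut b_aut
  | Lc => mk_aut c_aut
  | Ld => mk_aut d_aut
  end.

Definition in_Gtilde : pred treeAut :=
  fun g => `[< generated (range aut_gen) g >].

Record Gtilde := GtildeElt { Gtilde_aut :> treeAut; _ : in_Gtilde Gtilde_aut }.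

HB.instance Definition _ := [isSub for Gtilde_aut].
HB.instance Definition _ := [Choice of Gtilde by <:].
HB.instance Definition _ := SubChoice_isSubGroup.Build treeAut in_Gtilde Gtilde
  (generated_closed (range aut_gen)).

Lemma aut_gen_in l : in_Gtilde (aut_gen l).
Proof. by apply/asboolP/sub_generated; exists l. Qed.

Definition Ggen (l : letter) : Gtilde := GtildeElt (aut_gen_in l).

Definition subst_letter (l : letter) : seq letter :=
  match l with
  | La => [:: La; Lb; La]
  | Lb => [:: Ld]
  | Lc => [:: Lb]
  | Ld => [:: Lc]
  end.

Definition subst (w : seq letter) : seq letter := flatten (map subst_letter w).

Definition expanding (s : seq letter -> seq letter) : Prop :=
  (forall w, size w <= size (s w)) /\
  (forall w : seq letter, La \in w -> size w < size (s w)).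

Definition value (G : groupType) (gen : letter -> G) (w : seq letter) : G :=
  \prod_(l <- w) gen l.

Definition wpow (w : seq letter) (n : nat) : seq letter := flatten (nseq n w).

Definition seed_words : seq (seq letter) :=
  [:: wpow [:: La; Lc] 4;
      wpow [:: La; Ld] 4;
      wpow [:: La; Lc; La; Ld] 2;
      wpow [:: La; Lb] 8;
      wpow [:: La; Lb; La; Lb; La; Lc] 4;
      wpow [:: La; Lb; La; Lb; La; Ld] 4;
      wpow [:: La; Lb; La; Lb; La; Lc; La; Lb; La; Lb; La; Ld] 2].

Definition basic_relators : seq (freeGroup letter) :=
  let a := free_gen La in let b := free_gen Lb in
  let c := free_gen Lc in let d := free_gen Ld in
  [:: a ^+ 2; b ^+ 2; c ^+ 2; d ^+ 2; comm b c; comm b d; comm c d].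

Definition relators : set (freeGroup letter) :=
  [set r | r \in basic_relators] `|`
  [set r | exists (i : nat) (w : seq letter),
     w \in seed_words /\ r = value (@free_gen letter) (iter i subst w)].

(* Main.v *)
Require Import Defs.
From HB Require Import structures.
From mathcomp Require Import all_boot all_classical.
From mathcomp Require Import zify.
Set Implicit Arguments.
Unset Strict Implicit.
Unset Printing Implicit Defensive.
Local Open Scope classical_set_scope.
Local Open Scope group_scope.

(**
Write <<u, v>> for the automorphism that fixes the first level and acts as u
below the vertex 0 and as v below 1, so that b = <<a, c>>, c = <<1, d>> and
d = <<1, b>>; write s for the substitution subst.  Since s(a) = aba = <<c, a>>,
s(b) = d, s(c) = b and s(d) = c, one has s(w) = <<phi(w), w>> for every word w,
where phi is the substitution exchanging a and c and erasing b and d.  The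
values of phi lie in the dihedral group <a, c> of order 8.  Everything follows
from this formula.

The relators hold in Gtilde.  The seeds are checked by computing their sections.
Then s^(i+1)(w) = <<phi(s^i(w)), s^i(w)>> is trivial for a seed w by induction
on i, because phi(s^i(w)) is trivial: for i = 0 by the involutions and
(ac)^4 = 1, and for i > 0 because phi(s(u)) is a power of a whose exponent is
the number of letters d in u, which is even as every seed is a square.

The relators suffice.  Let P be the group that they present; both s and phi act
on P.  Let w be a word of even parity in a, with sections w0 and w1.  The key
identity, section_inverse, is that in P

    w = a s(z) a . s(w1)     with z = w0 phi(w1)^-1,

which reflects <<w0, w1>> = <<z, 1>> <<phi(w1), w1>>.  It is proved by adding
letters to w one at a time, and needs only that c and d commute with a s(z) a.
Now z is a product of conjugates of b and d by elements of <a, c>, so this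
reduces to finitely many commutators; those are conjugates of the seeds.
Consequently a word whose two sections are trivial in P is trivial in P.  Since
the sections of a suitably rotated word contain at most half as many letters a,
induction shows that a word acting trivially on the tree is trivial in P; the
words without a are settled by the faithfulness of the action of <b, c, d>.

The endomorphism.  The presentation shows that s is well defined on Gtilde, and
it is injective because w is the section of s(w) at 1.  The element t = abcd has
infinite order, since t^2 = <<t^-1, t>>.  If t^k with k > 0 were in the image of
s, the section t^-k of t^2k at 0 would be in the finite group <a, c>.  So
the powers of t lie in distinct cosets of the image.
*)

(** * Groups given by generators and relators *)

Section NormalClosure.
Local Open Scope quotient_scope.
Variables (G : groupType) (S : set G).
Local Notation N := (normal_closure S).

Lemma normal_closure1 : N 1.
Proof. by move=> K [K1 _] _ _. Qed.

Lemma normal_closureF x y : N x -> N y -> N (x / y).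
Proof. by move=> Nx Ny K cK JK SK; apply: cK.2; [apply: Nx | apply: Ny]. Qed.

Lemma normal_closureV x : N x -> N x^-1.
Proof.
by move=> Nx; rewrite -[x^-1]mul1g; exact: normal_closureF normal_closure1 Nx.
Qed.

Lemma normal_closureM x y : N x -> N y -> N (x * y).
Proof.
by move=> Nx Ny; rewrite -[y]invgK; exact/normal_closureF/normal_closureV.
Qed.

Lemma normal_closureJ x y : N x -> N (x ^ y).
Proof. by move=> Nx K cK JK SK; apply: (JK); apply: Nx. Qed.

Lemma sub_normal_closure x : S x -> N x.
Proof. by move=> Sx K _ _; apply. Qed.

Definition mod_normal_closure : rel G := fun x y => `[< N (x / y) >].

Lemma mod_normal_closure_equiv : equiv_class_of mod_normal_closure.
Proof.
split=> [x | x y | y x z]; rewrite /mod_normal_closure.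
- by rewrite mulgV; apply/asboolP/normal_closure1.
- by apply/asbool_equiv_eq; split=> /normal_closureV; rewrite invgF.
move=> /asboolP Nxy /asboolP Nyz; apply/asboolP.
by rewrite -(divgKA y) -[y * z^-1]/(y / z); apply: normal_closureM.
Qed.

Canonical mod_normal_closure_rel := EquivRelPack mod_normal_closure_equiv.

Definition normal_quotient := {eq_quot mod_normal_closure_rel}.
HB.instance Definition _ := Choice.on normal_quotient.
Local Notation Q := normal_quotient.

Definition quo (x : G) : Q := \pi_{eq_quot mod_normal_closure_rel} x.
Definition quo_rep (q : Q) : G :=
  generic_quotient.repr (q : {eq_quot mod_normal_closure_rel}).

Lemma quo_repK : cancel quo_rep quo.
Proof. exact: reprK. Qed.

Lemma quo_eq x y : quo x = quo y <-> N (x / y).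
Proof.
by split=> [/eqmodP | Nxy]; [move/asboolP | apply/eqmodP/asboolP].
Qed.

Definition quo_mul (p q : Q) : Q := quo (quo_rep p * quo_rep q).
Definition quo_inv (p : Q) : Q := quo (quo_rep p)^-1.

Lemma quo_mulE x y : quo_mul (quo x) (quo y) = quo (x * y).
Proof.
apply/quo_eq; set x' := quo_rep _; set y' := quo_rep _.
have Nx : N (x' / x) by apply/quo_eq/quo_repK.
have Ny : N (y' / y) by apply/quo_eq/quo_repK.
suff -> : x' * y' / (x * y) = x' / x * (y' / y) ^ x^-1.
  exact/normal_closureM/normal_closureJ.
by rewrite conjgE invgK invgM !mulgA mulgVK.
Qed.

Lemma quo_mulA : associative quo_mul.
Proof.
move=> p q r; rewrite -[p]quo_repK -[q]quo_repK -[r]quo_repK.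
by rewrite !quo_mulE mulgA.
Qed.

Lemma quo_mul1 : left_id (quo 1) quo_mul.
Proof. by move=> p; rewrite -[p]quo_repK quo_mulE mul1g. Qed.

Lemma quo_mulr1 : right_id (quo 1) quo_mul.
Proof. by move=> p; rewrite -[p]quo_repK quo_mulE mulg1. Qed.

Lemma quo_mulV : left_inverse (quo 1) quo_inv quo_mul.
Proof. by move=> p; rewrite -{2}[p]quo_repK quo_mulE mulVg. Qed.

Lemma quo_mulrV : right_inverse (quo 1) quo_inv quo_mul.
Proof. by move=> p; rewrite -{1}[p]quo_repK quo_mulE mulgV. Qed.

HB.instance Definition _ := isGroup.Build normal_quotient
  quo_mulA quo_mul1 quo_mulr1 quo_mulV quo_mulrV.

Lemma quo_morphism : monoid_morphism quo.
Proof. by split=> // x y; rewrite -quo_mulE. Qed.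

HB.instance Definition _ := isUMagmaMorphism.Build G Q quo quo_morphism.

End NormalClosure.

(** Every element of the free group is the product of the letters of its reduced
word, so a morphism is determined by the images of the generators. *)
Lemma free_lift_unique (X : choiceType) (G : groupType)
    (f : UMagmaMorphism.type (freeGroup X) G) :
  free_lift (f \o @free_gen X) =1 f.
Proof.
move=> u; have {2}-> : u = \prod_(l <- fword u) eval_letter (@free_gen X) l.
  apply: val_inj; case: u => w /= rw; elim: w rw => [|l w IHw] rw.
    by rewrite big_nil.
  rewrite big_cons /=; move/(_ (path_sorted rw)): IHw => <-.
  by move: rw => /reduce_id; case: l => x [] /= <-.
rewrite gmulf_prod; apply: eq_bigr => l _.
by rewrite /eval_letter; case: ifP => // _; rewrite gmulfV.
Qed.

Lemma exists_presentation (X : choiceType) (R : set (freeGroup X)) :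
  exists (G : groupType) (gen : X -> G), is_presentation gen R.
Proof.
exists (normal_quotient R), (quo R \o @free_gen X).
split=> [q | u]; last first.
  by rewrite free_lift_unique -[1]/(quo R 1) quo_eq divg1.
by exists (quo_rep q); rewrite free_lift_unique; apply: quo_repK.
Qed.

Lemma presentation_lift (X : choiceType) (G H : groupType) (gen : X -> G)
    (R : set (freeGroup X)) (h : X -> H) (u : freeGroup X) :
  is_presentation gen R -> (forall r, R r -> free_lift h r = 1) ->
  free_lift gen u = 1 -> free_lift h u = 1.
Proof.
move=> [_ kerR] killR /kerR.
move/(_ [pred v | `[< free_lift h v = 1 >]]) => H0; apply/asboolP/H0.
- split=> [|x y /asboolP hx /asboolP hy]; apply/asboolP; first exact: gmulf1.
  by rewrite gmulfF /= hx hy divg1.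
- by move=> x y /asboolP hx; apply/asboolP; rewrite gmulfJ /= hx conj1g.
by move=> r /killR /asboolP.
Qed.

(** * Evaluating words over the four generators *)

Definition satisfies_basic (G : groupType) (gen : letter -> G) : Prop :=
  (forall l, gen l * gen l = 1) /\
  (forall l m, l != La -> m != La -> commute (gen l) (gen m)).

(** The relators, stated in terms of words in which no inverse letter occurs;
see satisfies_relatorsP. *)
Definition satisfies_relators (G : groupType) (gen : letter -> G) : Prop :=
  satisfies_basic gen /\
  forall i w, w \in seed_words -> value gen (iter i subst w) = 1.

Section Value.
Variables (G : groupType) (gen : letter -> G).
Implicit Types (u v w x y : seq letter) (l m : letter).
Local Notation "[[ w ]]" := (value gen w) (at level 0, format "[[ w ]]").

Lemma value_nil : [[ [::] ]] = 1.
Proof. exact: big_nil. Qed.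

Lemma value_cons l w : [[l :: w]] = gen l * [[w]].
Proof. exact: big_cons. Qed.

Lemma value_cat u v : [[u ++ v]] = [[u]] * [[v]].
Proof. exact: big_cat. Qed.

Lemma value1 l : [[ [:: l] ]] = gen l.
Proof. exact: big_seq1. Qed.

Lemma value_pow w n : [[wpow w n]] = [[w]] ^+ n.
Proof.
elim: n => [|n IHn]; first exact: value_nil.
by rewrite /wpow /= value_cat -/(wpow w n) IHn expgS.
Qed.

Lemma free_lift_value w : free_lift gen (value (@free_gen letter) w) = [[w]].
Proof. by rewrite gmulf_prod; apply: eq_bigr => l _; apply: free_lift_gen. Qed.

Hypothesis basic_gen : satisfies_basic gen.

Lemma genK l : gen l * gen l = 1.
Proof. exact: basic_gen.1. Qed.

Lemma genV l : (gen l)^-1 = gen l.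
Proof. exact/mulg1_eq/genK. Qed.

Lemma value_rev w : [[rev w]] = [[w]]^-1.
Proof.
elim: w => [|l w IHw]; first by rewrite value_nil invg1.
by rewrite rev_cons -cats1 value_cat value1 IHw value_cons invgM genV.
Qed.

(** The generators are involutions, so the signs of the letters of a reduced
word can be dropped. *)
Lemma free_liftE (u : freeGroup letter) :
  free_lift gen u = [[map fst (fword u)]].
Proof.
rewrite /value big_map; apply: eq_bigr => l _.
by rewrite /eval_letter genV; case: ifP.
Qed.

End Value.

Lemma value_flatten (G : groupType) (gen : letter -> G)
    (f : letter -> seq letter) w :
  value gen (flatten (map f w)) = value (fun l => value gen (f l)) w.
Proof.
by elim: w => [|l w IHw]; rewrite ?value_nil //= value_cat IHw value_cons.
Qed.

Lemma satisfies_relatorsP (G : groupType) (gen : letter -> G) :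
  satisfies_relators gen <-> forall r, relators r -> free_lift gen r = 1.
Proof.
have liftg l : free_lift gen (free_gen l) = gen l := free_lift_gen gen l.
have liftX l : free_lift gen (free_gen l ^+ 2) = gen l * gen l.
  by rewrite gmulfXn expg2 /= liftg.
have liftC l m : free_lift gen (comm (free_gen l) (free_gen m)) = 1 <->
    commute (gen l) (gen m).
  rewrite /comm !gmulfM /= !gmulfV /= !liftg -mulgA -invgM.
  by split=> [/divg1_eq | ->]; rewrite ?mulgV.
split=> [[[invg comg] seeds] r | kill].
  case=> [| [i [w [sw ->]]]]; last by rewrite free_lift_value seeds.
  rewrite /= !inE => Hr; do ![case/predU1P: Hr => [-> | Hr]];
    rewrite ?liftX ?invg //; try by apply/liftC/comg.
  by rewrite (eqP Hr); apply/liftC/comg.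
have basic_kill r : r \in basic_relators -> free_lift gen r = 1.
  by move=> Hr; apply: kill; left.
have comg l m : l != La -> m != La -> nat_of_letter l < nat_of_letter m ->
    commute (gen l) (gen m).
  move=> la ma lm; apply/liftC/basic_kill.
  by case: l m la ma lm => [] []; rewrite // !inE eqxx ?orbT.
split; last first.
  move=> i w sw; rewrite -free_lift_value; apply: kill.
  by right; exists i, w.
split=> [l | l m la ma].
  by rewrite -liftX; apply: basic_kill; case: l; rewrite !inE eqxx ?orbT.
case: (ltngtP (nat_of_letter l) (nat_of_letter m)) => [lm | ml | lm].
- exact: comg.
- exact/commute_sym/comg.
by rewrite (can_inj nat_of_letterK lm).
Qed.

(** Left multiplication by a letter on normal forms of the free product of <a>
with the elementary abelian group <b, c, d>, where each run of letters other
than a is sorted.  It decides equalities that only use the basic relators. *)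
Fixpoint insert l w : seq letter :=
  if w is m :: w' then
    if l == m then w'
    else if [&& l != La, m != La & nat_of_letter m < nat_of_letter l]
         then m :: insert l w' else l :: w
  else [:: l].

Definition norm w := foldr insert [::] w.

Section Norm.
Variables (G : groupType) (gen : letter -> G).
Hypothesis basic_gen : satisfies_basic gen.

Lemma value_insert l w : value gen (insert l w) = gen l * value gen w.
Proof.
elim: w => [|m w IHw] /=; first by rewrite value_cons.
case: eqP => [->|_]; first by rewrite value_cons mulgA (genK basic_gen) mul1g.
case: ifP => [/and3P[la ma _]|_]; last by rewrite !value_cons.
by rewrite !value_cons IHw !mulgA (basic_gen.2 _ _ la ma).
Qed.

Lemma value_norm w : value gen (norm w) = value gen w.
Proof. by elim: w => //= l w IHw; rewrite value_insert IHw value_cons. Qed.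

Lemma value_eq_norm u v : norm u = norm v -> value gen u = value gen v.
Proof. by move=> uv; rewrite -[LHS]value_norm uv value_norm. Qed.

(** The words t, r, u and v are concrete in the applications, so that the
hypothesis on normal forms, which makes u / v a conjugate of r modulo the basic
relators, holds by computation. *)
Lemma value_eq_relator t r u v : value gen r = 1 ->
  norm (u ++ rev v) = norm (t ++ r ++ rev t) -> value gen u = value gen v.
Proof.
move=> r1 /value_eq_norm; rewrite !value_cat r1 mul1g !value_rev // mulgV.
exact: divg1_eq.
Qed.

End Norm.

(** * The two substitutions *)

(** phi w is the section of subst w at the vertex 0, while its section at 1 is w
itself; see section_at_subst. *)
Definition phi_letter l : seq letter :=
  match l with La => [:: Lc] | Lc => [:: La] | _ => [::] end.
Definition phi w := flatten (map phi_letter w).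

Lemma flatten_map_cat (T : Type) (f : T -> seq T) (u v : seq T) :
  flatten (map f (u ++ v)) = flatten (map f u) ++ flatten (map f v).
Proof. by rewrite map_cat flatten_cat. Qed.

Lemma subst_cat u v : subst (u ++ v) = subst u ++ subst v.
Proof. exact: flatten_map_cat. Qed.

Lemma phi_cat u v : phi (u ++ v) = phi u ++ phi v.
Proof. exact: flatten_map_cat. Qed.

Lemma iter_subst_cat i u v :
  iter i subst (u ++ v) = iter i subst u ++ iter i subst v.
Proof. by elim: i => //= i ->; rewrite subst_cat. Qed.

Definition square_root (w : seq letter) := take (size w)./2 w.

Lemma seed_square w : w \in seed_words -> w = square_root w ++ square_root w.
Proof.
by rewrite !inE => Hw; do ![case/predU1P: Hw => [-> // | Hw]]; rewrite (eqP Hw).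
Qed.

(** Representatives of the elements of <a, c> when (ac)^4 = 1. *)
Definition dihedral_words :=
  [:: [::]; [:: La]; [:: Lc]; [:: La; Lc]; [:: Lc; La]; [:: La; Lc; La];
      [:: Lc; La; Lc]; [:: La; Lc; La; Lc]].

Section Transport.
Variables (G : groupType) (gen : letter -> G).
Hypothesis basic_gen : satisfies_basic gen.

Lemma satisfies_basic_subst :
  satisfies_basic (fun l => value gen (subst_letter l)).
Proof.
split=> [l | l m la ma].
  by rewrite -value_cat -(value_nil gen); apply: value_eq_norm => //; case: l.
rewrite /commute -!value_cat; apply: value_eq_norm => //.
by case: l m la ma => [] [].
Qed.

Lemma satisfies_basic_phi :
  satisfies_basic (fun l => value gen (phi_letter l)).
Proof.
split=> [l | l m la ma].
  by rewrite -value_cat -(value_nil gen); apply: value_eq_norm => //; case: l.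
rewrite /commute -!value_cat; apply: value_eq_norm => //.
by case: l m la ma => [] [].
Qed.

(** The composite sends a to cc and erases b and c: only d, which subst maps to c,
leaves a letter a. *)
Lemma value_phi_subst w :
  value gen (phi (subst w)) = gen La ^+ count_mem Ld w.
Proof.
elim: w => [|l w IHw]; first exact: value_nil.
rewrite -cat1s subst_cat phi_cat value_cat IHw count_cat expgnDr; congr (_ * _).
case: l => /=; rewrite ?expg1 ?expg0 -?(value1 gen La) -?(value_nil gen);
  exact: value_eq_norm.
Qed.

(** From i = 1 on, value_phi_subst applies, and the number of letters d is even
because a seed is a square. *)
Lemma value_phi_seed i w : value gen (wpow [:: La; Lc] 4) = 1 ->
  w \in seed_words -> value gen (phi (iter i subst w)) = 1.
Proof.
move=> ac4 sw; case: i => [|i]; last first.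
  rewrite iterS value_phi_subst (seed_square sw) iter_subst_cat count_cat addnn.
  by rewrite -mul2n expgnA expg2 genK // expg1n.
rewrite -(value_nil gen) /=; move: sw; rewrite !inE => Hw.
do ![case/predU1P: Hw => [-> | Hw]]; last rewrite (eqP Hw);
  by [apply: value_eq_norm
    | apply: (value_eq_relator basic_gen (t := [:: La]) ac4)].
Qed.

Lemma value_phi_dihedral v : value gen (wpow [:: La; Lc] 4) = 1 ->
  exists2 y, y \in dihedral_words & value gen (phi v) = value gen y.
Proof.
move=> ac4; have step m y : m \in [:: La; Lc] -> y \in dihedral_words ->
    exists2 y', y' \in dihedral_words & value gen (m :: y) = value gen y'.
  rewrite !inE => /orP[/eqP-> | /eqP->] Hy;
    do ![case/predU1P: Hy => [-> | Hy]]; rewrite ?(eqP Hy);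
    try by match goal with |- exists2 y', _ & value gen ?w = _ =>
             exists (norm w) => //; apply: value_eq_norm end.
  (* The products caca and cacac leave the list, and (ac)^4 brings them back. *)
  - exists [:: La; Lc; La; Lc] => //.
    exact: (value_eq_relator basic_gen (t := [:: La]) ac4).
  - exists [:: La; Lc; La] => //.
    exact: (value_eq_relator basic_gen (t := [:: La]) ac4).
elim: v => [|l v [y yD IHv]]; first by exists [::].
have cons m : m \in [:: La; Lc] ->
    exists2 y', y' \in dihedral_words & value gen (m :: phi v) = value gen y'.
  by move=> mac; rewrite value_cons IHv -value_cons; exact: step.
case: l => /=; [exact: cons | by exists y | exact: cons | by exists y].
Qed.

End Transport.

(** The set of relators is closed under subst by construction. *)
Lemma satisfies_relators_subst (G : groupType) (gen : letter -> G) :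
  satisfies_relators gen ->
  satisfies_relators (fun l => value gen (subst_letter l)).
Proof.
case=> basic_gen seeds; split=> [|i w sw]; first exact: satisfies_basic_subst.
by rewrite -value_flatten -[flatten _]/(subst _) -iterS seeds.
Qed.

Lemma satisfies_relators_phi (G : groupType) (gen : letter -> G) :
  satisfies_relators gen ->
  satisfies_relators (fun l => value gen (phi_letter l)).
Proof.
case=> basic_gen seeds; split=> [|i w sw]; first exact: satisfies_basic_phi.
rewrite -value_flatten -[flatten _]/(phi _) value_phi_seed //.
exact: (seeds 0).
Qed.

(** * Sections, and how to recover a word from them *)

(** The parity of w tells how w permutes the first level of the tree. *)
Definition parity (w : seq letter) := odd (count_mem La w).

Definition letter_section l (x : bool) : seq letter :=
  match l, x with
  | Lb, false => [:: La]
  | Lb, true => [:: Lc]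
  | Lc, true => [:: Ld]
  | Ld, true => [:: Lb]
  | _, _ => [::]
  end.

(** The action is on the left, so the last letter of w acts first, and l meets
the vertex that w' has moved x to. *)
Fixpoint section_at (x : bool) w : seq letter :=
  if w is l :: w' then letter_section l (x (+) parity w') ++ section_at x w'
  else [::].

(** When w acts as <<w0, w1>>, this is the first component of the product of w
and the inverse of subst w1 = <<phi w1, w1>>, whose second component is 1. *)
Definition left_residue w :=
  section_at false w ++ rev (phi (section_at true w)).

Section SectionInverse.
Variables (G : groupType) (gen : letter -> G).
Hypothesis model_gen : satisfies_relators gen.

Let basic_gen := model_gen.1.
Local Notation S w := (value gen (subst w)).
Local Notation a := (gen La).

(** As subst w = <<phi w, w>>, its conjugate by a is <<w, phi w>>. *)
Definition left_copy (g : G) : G := a * g * a.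

Lemma left_copyM g h : left_copy (g * h) = left_copy g * left_copy h.
Proof. by rewrite /left_copy -!mulgA (mulgA a a) genK // mul1g. Qed.

(** In Gtilde this holds when phi w is trivial, since c and d act trivially
below the vertex 0. In the presented group it has to be derived from the
relators. *)
Definition left_copy_commutes (w : seq letter) : Prop :=
  forall t, t \in [:: Lc; Ld] -> commute (gen t) (left_copy (S w)).

Lemma left_copy_commutes_eq u v : S u = S v ->
  left_copy_commutes u -> left_copy_commutes v.
Proof. by rewrite /left_copy_commutes => ->. Qed.

Lemma left_copy_commutes_cat u v :
  left_copy_commutes u -> left_copy_commutes v -> left_copy_commutes (u ++ v).
Proof.
move=> Hu Hv t tcd; rewrite subst_cat value_cat left_copyM.
by apply: commuteM; [apply: Hu | apply: Hv].
Qed.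

Lemma commute_by_relator u v : (exists r t, r \in seed_words /\
    norm ((u ++ v) ++ rev (v ++ u)) = norm (t ++ r ++ rev t)) ->
  commute (value gen u) (value gen v).
Proof.
move=> [r [t [/(model_gen.2 0) r1 uv]]]; rewrite /commute -!value_cat.
exact: value_eq_relator uv.
Qed.

(** Enough conjugating words to recognise each commutator below as a conjugate
of a seed. The word X = ababa is the one through which the three longest seeds
are commutators of c or d with X c X or X d X. *)
Definition conjugators :=
  let X := [:: La; Lb; La; Lb; La] in
  [:: [:: La]; [:: Lc]; [:: Ld]; X;
      [:: Lb; La]; [:: Lb; Lc]; [:: Lb; Ld]; Lb :: X].

Definition left_copy_word w := La :: rcons (subst w) La.

(** The seeds make c and d commute with the left copies of the conjugates of b
and d by <a, c>; this is a finite verification. *)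
Lemma commutators_of_copies :
  all (fun y => all (fun s => all (fun t =>
    let g := left_copy_word (y ++ s :: rev y) in
    has (fun r => has (fun x =>
      norm ((t :: g) ++ rev (rcons g t)) == norm (x ++ r ++ rev x))
      conjugators) seed_words)
    [:: Lc; Ld]) [:: Lb; Ld]) dihedral_words.
Proof. by vm_compute. Qed.

Lemma left_copy_commutes_conj y s :
  y \in dihedral_words -> s \in [:: Lb; Ld] ->
  left_copy_commutes (y ++ s :: rev y).
Proof.
move=> yD sbd t tcd; set w := y ++ _.
have -> : left_copy (S w) = value gen (left_copy_word w).
  by rewrite value_cons -cats1 value_cat value1 mulgA.
rewrite -(value1 gen t); apply: commute_by_relator.
have /allP/(_ s sbd)/allP/(_ t tcd) := allP commutators_of_copies y yD.
by move=> /hasP[r sr] /hasP[x _ /eqP Hx]; exists r, x; rewrite cats1.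
Qed.

(** Commutation is required for all conjugates under <a, c>, whose elements
are the values of phi, in order to have a property stable under such
conjugations. *)
Definition copies_commute w : Prop :=
  forall v, left_copy_commutes (phi v ++ w ++ rev (phi v)).

Lemma subst_rev w : subst (rev w) = rev (subst w).
Proof.
elim: w => // l w IHw; rewrite rev_cons -cats1 subst_cat IHw -cat1s subst_cat.
by rewrite rev_cat; congr (_ ++ _); case: l.
Qed.

Lemma value_subst_rev w : S (rev w) = (S w)^-1.
Proof. by rewrite subst_rev value_rev. Qed.

Lemma copies_commute_nil : copies_commute [::].
Proof.
move=> v t _; rewrite /left_copy cat0s subst_cat value_cat value_subst_rev.
rewrite mulgV mulg1 genK //; exact: commute1.
Qed.

(** A conjugate of sw is the product of a conjugate of s, covered by the finite
computation, and a conjugate of w. *)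
Lemma copies_commute_cons s w :
  s \in [:: Lb; Ld] -> copies_commute w -> copies_commute (s :: w).
Proof.
move=> sbd gw v.
have [y yD phi_y] : exists2 y, y \in dihedral_words & S (phi v) = S y.
  have [basic_subst seeds] := satisfies_relators_subst model_gen.
  have [|y yD] := value_phi_dihedral basic_subst v; first exact: (seeds 0).
  by rewrite -!value_flatten => phi_y; exists y.
have sd := left_copy_commutes_cat (left_copy_commutes_conj yD sbd) (gw v).
apply: left_copy_commutes_eq sd.
rewrite -[s :: w]cat1s -[s :: rev y]cat1s !subst_cat !value_cat.
by rewrite !value_subst_rev phi_y !mulgA mulgVK.
Qed.

Lemma copies_commute_conj l m w : phi_letter l = [:: m] ->
  copies_commute w -> copies_commute (m :: rcons w m).
Proof.
move=> lm gw v; have := gw (rcons v l).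
by rewrite -cats1 phi_cat /phi /= lm rev_cat -cats1 -!catA.
Qed.

(** The right-hand side is a partial inverse of the map from words to pairs of
sections.  Words of odd parity are first multiplied by a, so that the identity
can be proved one letter at a time; multiplying by a on the left leaves the
sections unchanged.  Adding b conjugates the residue by a letter a or c, and
adding c or d multiplies the residue by d or b, or moves c or d past the left
copy of the residue. *)
Lemma section_inverse w :
  copies_commute (left_residue w) /\
  value gen (if parity w then La :: w else w) =
    left_copy (S (left_residue w)) * S (section_at true w).
Proof.
have genKl l x : gen l * (gen l * x) = x by rewrite mulgA genK // mul1g.
elim: w => [|l w [gw IHw]].
  split; first exact: copies_commute_nil.
  by rewrite /left_residue /= !value_nil /left_copy !mulg1 genK.
have dc t x : t \in [:: Lc; Ld] ->
    gen t * (a * (S (left_residue w) * (a * x))) =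
    a * (S (left_residue w) * (a * (gen t * x))).
  move=> tcd; have := gw [::] t tcd; rewrite /= cats0 /commute /left_copy.
  by rewrite -!mulgA => /(congr1 (fun g => g * x)); rewrite -!mulgA.
have valw : value gen w = (if parity w then a else 1) *
    (left_copy (S (left_residue w)) * S (section_at true w)).
  by rewrite -IHw; case: ifP; rewrite ?mul1g // value_cons genKl.
have parE : parity (l :: w) = (l == La) (+) parity w.
  by rewrite /parity /= oddD; case: l.
have residueE : left_residue (l :: w) =
    letter_section l (parity w) ++ left_residue w ++
    (if l is Lb then if parity w then [:: Lc] else [:: La] else [::]).
  rewrite /left_residue /= phi_cat rev_cat !catA; congr (_ ++ _).
  by case: (l); case: (parity w).
have S0 : S [::] = 1 := value_nil gen.
have S1 k : S [:: k] = value gen (subst_letter k) by rewrite /subst /= cats0.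
rewrite parE residueE [section_at true _]/=; move: gw dc valw.
rewrite /left_copy.
move: (left_residue w) (section_at true w) => z s gz dc valw.
split.
  case: l {parE residueE}; case: (parity w); rewrite /= ?cats0 // ?cats1.
  - exact: (copies_commute_conj (l := La)) gz.
  - exact: (copies_commute_conj (l := Lc)) gz.
  - exact: copies_commute_cons gz.
  - exact: copies_commute_cons gz.
rewrite !subst_cat !value_cat.
case: l {parE residueE}; case: (parity w) valw => /= valw;
  rewrite ?value_cons valw ?S0 ?S1 /= ?value_cons ?value_nil ?mul1g ?mulg1;
  rewrite -?mulgA ?genKl //.
all: by rewrite -?mulgA ?genKl ?dc.
Qed.

End SectionInverse.

(** * The relators hold in the group *)

Definition word_act (w : seq letter) (v : vertex) : vertex := foldr aut_gen v w.
Definition trivial_action w := forall v, word_act w v = v.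

Lemma word_act_cat u v x : word_act (u ++ v) x = word_act u (word_act v x).
Proof. exact: foldr_cat. Qed.

Lemma word_act_nil w : word_act w [::] = [::].
Proof. by elim: w => // l w /= ->; case: l. Qed.

Lemma word_act_cons w x v :
  word_act w (x :: v) = (x (+) parity w) :: word_act (section_at x w) v.
Proof.
elim: w => [|l w IHw] /=; first by rewrite addbF.
rewrite IHw word_act_cat /parity /= oddD.
by case: l => /=; case: (x (+) _) (addbA x true (odd (count_mem La w)));
  case: x {IHw} => //=; case: odd => //=; case: (word_act _ v).
Qed.

Lemma trivial_actionP w : trivial_action w <->
  [/\ ~~ parity w, trivial_action (section_at false w) &
      trivial_action (section_at true w)].
Proof.
split=> [tw | [/negPf pw t0 t1] [|[] v]].
- split=> [|v|v].
  + by have := tw [:: false]; rewrite word_act_cons word_act_nil; case: parity.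
  + by have := tw (false :: v); rewrite word_act_cons => -[].
  + by have := tw (true :: v); rewrite word_act_cons => -[].
- exact: word_act_nil.
- by rewrite word_act_cons pw t1.
- by rewrite word_act_cons pw t0.
Qed.

Lemma Ggen_valueE w v : (value Ggen w : treeAut) v = word_act w v.
Proof.
by elim: w v => [|l w IHw] v; rewrite ?value_nil // value_cons /= -IHw.
Qed.

Lemma value_Ggen_eq u v :
  value Ggen u = value Ggen v <-> word_act u =1 word_act v.
Proof.
split=> [uv x | uv]; first by rewrite -!Ggen_valueE uv.
apply/val_inj/val_inj/funext => x.
exact: etrans (Ggen_valueE u x) (etrans (uv x) (esym (Ggen_valueE v x))).
Qed.

Lemma value_Ggen_eq1 w : value Ggen w = 1 <-> trivial_action w.
Proof. by rewrite -(value_nil Ggen); exact: value_Ggen_eq. Qed.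

Lemma bcd_commute v : [/\ b_fun (c_fun v) = c_fun (b_fun v),
  b_fun (d_fun v) = d_fun (b_fun v) & c_fun (d_fun v) = d_fun (c_fun v)].
Proof.
elim: v => [//|[] v [IH1 IH2 IH3]] /=; first by rewrite IH1 IH2 IH3.
by split => //; case: v {IH1 IH2 IH3}.
Qed.

Lemma satisfies_basic_Ggen : satisfies_basic Ggen.
Proof.
have [bK cK dK] := bcd_involutive.
split=> [l | l m la ma].
  apply/val_inj/val_inj/funext; case: l => v.
  - exact: a_involutive.
  - exact: bK.
  - exact: cK.
  - exact: dK.
apply/val_inj/val_inj/funext => v; have [bc bd cd] := bcd_commute v.
by case: l m la ma => [] []; rewrite //= ?bc ?bd ?cd.
Qed.

Lemma parity_subst w : parity (subst w) = false.
Proof.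
elim: w => // l w; rewrite -cat1s subst_cat /parity count_cat oddD => ->.
by case: l.
Qed.

Lemma section_at_cat x u v :
  section_at x (u ++ v) = section_at (x (+) parity v) u ++ section_at x v.
Proof.
elim: u => //= l u ->.
by rewrite /parity count_cat oddD [odd _ (+) odd _]addbC addbA catA.
Qed.

(** The identity subst w = <<phi w, w>>, which holds letter by letter. *)
Lemma section_at_subst w :
  section_at false (subst w) = phi w /\ section_at true (subst w) = w.
Proof.
elim: w => // l w [IH0 IH1]; rewrite -cat1s subst_cat phi_cat.
by rewrite !section_at_cat parity_subst IH0 IH1; case: l.
Qed.

Lemma trivial_action_subst w :
  trivial_action (subst w) <-> trivial_action (phi w) /\ trivial_action w.
Proof.
rewrite trivial_actionP parity_subst; have [-> ->] := section_at_subst w.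
by split=> [[] | []].
Qed.

Lemma value_ac4 : value Ggen (wpow [:: La; Lc] 4) = 1.
Proof.
apply/value_Ggen_eq1/trivial_actionP; split=> //; apply/value_Ggen_eq1;
  by rewrite -(value_nil Ggen); apply: value_eq_norm satisfies_basic_Ggen _ _ _.
Qed.

Lemma value_seed w : w \in seed_words -> value Ggen w = 1.
Proof.
have chk u : [&& ~~ parity u, norm (section_at false u) == [::]
    & norm (section_at true u) == [::]] -> value Ggen u = 1.
  case/and3P=> pu /eqP s0 /eqP s1; apply/value_Ggen_eq1/trivial_actionP.
  split=> //; apply/value_Ggen_eq1; rewrite -(value_nil Ggen);
    exact: (value_eq_norm satisfies_basic_Ggen).
rewrite !inE => Hw; do ![case/predU1P: Hw => [-> | Hw]]; last rewrite (eqP Hw).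
all: try by apply: chk.
(* The sections of (ab)^8 are not trivial modulo the basic relators, but this
word is the image of (ac)^4. *)
change (wpow [:: La; Lb] 8) with (subst (wpow [:: La; Lc] 4)).
apply/value_Ggen_eq1/trivial_action_subst; split; apply/value_Ggen_eq1.
  exact: (value_phi_seed satisfies_basic_Ggen 0 value_ac4).
exact: value_ac4.
Qed.

Lemma satisfies_relators_Ggen : satisfies_relators Ggen.
Proof.
split=> [|i w sw]; first exact: satisfies_basic_Ggen.
elim: i => [|i IHi]; first exact: value_seed.
have phi1 := value_phi_seed satisfies_basic_Ggen i value_ac4 sw.
apply/value_Ggen_eq1/(trivial_action_subst (iter i subst w)).
by split; apply/value_Ggen_eq1.
Qed.

(** * A word acting trivially is a consequence of the relators *)

(** The normal form x0 a x1 a ... a xn, with xi in <b, c, d>, as x0 and the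
list of the other xi. Cancellations between two letters a are not performed,
so that the number of syllables is known exactly. *)
Definition syllables w : seq letter * seq (seq letter) :=
  foldr (fun l p => if l is La then ([::], p.1 :: p.2) else (insert l p.1, p.2))
    ([::], [::]) w.

Definition word_of_syllables s : seq letter := flatten (map (cons La) s).

Definition bcd_words :=
  [:: [::]; [:: Lb]; [:: Lc]; [:: Ld]; [:: Lb; Lc]; [:: Lb; Ld]; [:: Lc; Ld];
      [:: Lb; Lc; Ld]].

Lemma value_syllables (G : groupType) (gen : letter -> G) w :
  satisfies_basic gen ->
  value gen ((syllables w).1 ++ word_of_syllables (syllables w).2) =
  value gen w.
Proof.
move=> basic_gen; elim: w => // l w; rewrite value_cat => IHw.
case: l => /=; rewrite value_cons -IHw value_cat.
- by rewrite value_cons mulgA.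
all: by rewrite value_insert // mulgA.
Qed.

Lemma size_syllables w : size (syllables w).2 = count_mem La w.
Proof. by elim: w => //= l w <-; case: l. Qed.

Lemma syllables_bcd w :
  ((syllables w).1 \in bcd_words) && all (mem bcd_words) (syllables w).2.
Proof.
have ins l y : l != La -> y \in bcd_words -> insert l y \in bcd_words.
  have : all (fun y => (l != La) ==> (insert l y \in bcd_words)) bcd_words.
    by case: l.
  by move/allP=> tab la /tab; rewrite la.
elim: w => // l w /andP[w1 w2].
by case: l => /=; rewrite ?w1 ?w2 ?andbT //; exact: ins.
Qed.

Lemma section_at_bcd y x : y \in bcd_words -> parity y = false /\
  count_mem La (section_at x y) <= ~~ x.
Proof.
have : all (fun y => (parity y == false) &&
    (count_mem La (section_at x y) <= ~~ x)) bcd_words by case: x.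
by move/allP=> tab /tab /andP[/eqP].
Qed.

(** In a section at x, the syllables are met alternately at the vertices 0 and
1, and one met at 1 contributes no letter a. The correction term, the vertex
to which x is finally moved, is what makes the bound inductive. *)
Lemma section_at_contracts x s : all (mem bcd_words) s ->
  parity (word_of_syllables s) = odd (size s) /\
  (count_mem La (section_at x (word_of_syllables s))).*2
    <= size s + (x (+) odd (size s)).
Proof.
elim: s => [|y s IHs] /=; first by rewrite addbF.
case/andP=> ybcd /IHs[ps IH]; rewrite section_at_cat count_cat ps.
have [py cy] := section_at_bcd (x (+) odd (size s)) ybcd; split.
  by move: py ps; rewrite /parity /= count_cat !oddD => -> ->.
move: IH cy; rewrite -/(word_of_syllables s).
by case: (x) => /=; case: (odd _) => /=; lia.
Qed.

(** The generators b, d and c are detected at the vertices 00, 100 and 1100: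
each of these is moved by one of the three letters and fixed by the other two.
*)
Lemma bcd_faithful y : y \in bcd_words -> trivial_action y -> y = [::].
Proof.
move=> Hy ty.
have : all (fun v => word_act y v == v)
  [:: [:: false; false]; [:: true; false; false];
      [:: true; true; false; false]].
  by rewrite /= !ty !eqxx.
move: Hy; rewrite !inE => Hy.
by do ![case/predU1P: Hy => [-> // | Hy]]; rewrite (eqP Hy).
Qed.

Section Presentation.
Variables (G : groupType) (gen : letter -> G).
Hypothesis pres : is_presentation gen relators.

Lemma presentation_satisfies_relators : satisfies_relators gen.
Proof.
by apply/satisfies_relatorsP => r Rr; apply/pres.2; exact: sub_normal_closure.
Qed.

(** The universal property of the presented group, for words. *)
Lemma presentation_value (H : groupType) (h : letter -> H) u :
  satisfies_relators h -> value gen u = 1 -> value h u = 1.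
Proof.
move=> /satisfies_relatorsP kill.
rewrite -(free_lift_value gen) -(free_lift_value h).
exact: presentation_lift pres kill.
Qed.

Lemma value_subst_eq1 u : value gen u = 1 -> value gen (subst u) = 1.
Proof.
rewrite value_flatten; apply: presentation_value.
exact: satisfies_relators_subst presentation_satisfies_relators.
Qed.

Lemma value_phi_eq1 u : value gen u = 1 -> value gen (phi u) = 1.
Proof.
rewrite value_flatten; apply: presentation_value.
exact: satisfies_relators_phi presentation_satisfies_relators.
Qed.

(** By induction on the number of letters a.  A trivial word with a letter a is
conjugate to one that starts with a; its sections then have at most half as many
letters a, hence are trivial in the presented group by induction, and
section_inverse concludes. *)
Lemma trivial_action_value w : trivial_action w -> value gen w = 1.
Proof.
have basic_gen := presentation_satisfies_relators.1.
have [n] := ubnP (count_mem La w); elim: n w => // n IHn w.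
have [aw | naw] := boolP (La \in w); last first.
  move=> _ tw; have Gw := value_syllables w satisfies_basic_Ggen.
  have gw := value_syllables w basic_gen; move: Gw gw.
  have /eqP := size_syllables w.
  rewrite (count_memPn naw) size_eq0 => /eqP->.
  rewrite cats0 => Gw <-; have /andP[ybcd _] := syllables_bcd w.
  rewrite (bcd_faithful ybcd) ?value_nil //.
  by apply/value_Ggen_eq1; rewrite Gw; apply/value_Ggen_eq1.
case/splitPr: aw => u v; set r := La :: v ++ u.
have rot (H : groupType) (h : letter -> H) :
    value h (u ++ La :: v) = 1 <-> value h r = 1.
  by rewrite /r -cat_cons !value_cat; split=> /mulg1_eq <-; rewrite mulVg.
have -> : count_mem La (u ++ La :: v) = count_mem La r.
  by rewrite /r -cat_cons !count_cat addnC.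
move=> rn /value_Ggen_eq1/rot Gr; apply/rot.
pose s := (syllables r).2; pose ws := word_of_syllables s.
have valr (H : groupType) (h : letter -> H) :
    satisfies_basic h -> value h ws = value h r.
  by move=> /(value_syllables r).
have /value_Ggen_eq1/trivial_actionP[even_ws t0 t1] : value Ggen ws = 1.
  by rewrite (valr _ _ satisfies_basic_Ggen).
have sn : size s < n.+1 by rewrite size_syllables.
have s_gt0 : 0 < size s by [].
have sbcd : all (mem bcd_words) s by have /andP[] := syllables_bcd r.
have small x : trivial_action (section_at x ws) ->
    value gen (section_at x ws) = 1.
  apply: IHn; have [ps] := section_at_contracts x sbcd.
  rewrite -ps (negPf even_ws) addbF -/ws.
  have := @even_halfK (size s); rewrite -ps => /(_ even_ws).
  by move: (size s) sn s_gt0 (count_mem _ _) => k; case: x => /=; lia.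
have [v0 v1] := (small _ t0, small _ t1).
rewrite -valr //.
have [_] := section_inverse presentation_satisfies_relators ws.
rewrite (negPf even_ws) => ->; rewrite /left_copy /left_residue subst_cat.
rewrite !value_cat (value_subst_rev presentation_satisfies_relators).
rewrite (value_subst_eq1 v0) (value_subst_eq1 v1).
by rewrite (value_subst_eq1 (value_phi_eq1 v1)) invg1 !mulg1 genK.
Qed.

End Presentation.

(** * The presentation and the endomorphism *)

Lemma value_Ggen_surj (g : Gtilde) : exists w, value Ggen w = g.
Proof.
pose K := [pred h | `[< exists w, Gtilde_aut (value Ggen w) = h >]].
suff /asboolP[w wg] : Gtilde_aut g \in K by exists w; apply: val_inj.
have /asboolP gen_g := valP g; apply: gen_g => [|_ [l _ <-]]; last first.
  by apply/asboolP; exists [:: l]; rewrite value1.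
split=> [|_ _ /asboolP[u <-] /asboolP[v <-]]; apply/asboolP.
  by exists [::]; rewrite value_nil.
by exists (u ++ rev v); rewrite value_cat (value_rev satisfies_basic_Ggen).
Qed.

Lemma presentation_Ggen : is_presentation Ggen relators.
Proof.
have [P [gen pres]] := exists_presentation relators.
split=> [g | u].
  by have [w <-] := value_Ggen_surj g; exists (value (@free_gen letter) w);
     rewrite free_lift_value.
split=> [|/pres.2]; last first.
  apply: presentation_lift pres _.
  exact/satisfies_relatorsP/satisfies_relators_Ggen.
rewrite (free_liftE satisfies_basic_Ggen) => /value_Ggen_eq1 tu; apply/pres.2.
rewrite (free_liftE (presentation_satisfies_relators pres).1).
exact: (trivial_action_value pres tu).
Qed.

Lemma value_subst_eq u v :
  value Ggen u = value Ggen v -> value Ggen (subst u) = value Ggen (subst v).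
Proof.
move=> uv; apply/divg1_eq.
rewrite -(value_subst_rev satisfies_relators_Ggen) -value_cat -subst_cat.
apply: (value_subst_eq1 presentation_Ggen).
by rewrite value_cat (value_rev satisfies_basic_Ggen) uv mulgV.
Qed.

Definition word_for (g : Gtilde) : seq letter := sval (cid (value_Ggen_surj g)).

Lemma word_forK : cancel word_for (value Ggen).
Proof. by move=> g; exact: svalP (cid (value_Ggen_surj g)). Qed.

Definition sigma (g : Gtilde) : Gtilde := value Ggen (subst (word_for g)).

Lemma sigma_value w : sigma (value Ggen w) = value Ggen (subst w).
Proof. exact/value_subst_eq/word_forK. Qed.

Lemma sigmaM : {morph sigma : g h / g * h}.
Proof.
move=> g h; rewrite -[g]word_forK -[h]word_forK -value_cat !sigma_value.
by rewrite subst_cat value_cat.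
Qed.

HB.instance Definition _ := isMultiplicative.Build Gtilde Gtilde sigma sigmaM.

Lemma value_section_at x u v : value Ggen u = value Ggen v ->
  value Ggen (section_at x u) = value Ggen (section_at x v).
Proof.
by move/value_Ggen_eq => uv; apply/value_Ggen_eq => t;
  have := uv (x :: t); rewrite !word_act_cons => -[].
Qed.

Lemma sigma_inj : injective sigma.
Proof.
move=> g h; rewrite -[g]word_forK -[h]word_forK !sigma_value.
move: (word_for g) (word_for h) => u v /(value_section_at true).
by have [_ ->] := section_at_subst u; have [_ ->] := section_at_subst v.
Qed.

Lemma section_at_wpow x w n : ~~ parity w ->
  section_at x (wpow w n) = wpow (section_at x w) n.
Proof.
move=> pw; elim: n => //= n IHn.
rewrite /wpow /= -!/(wpow _ n) section_at_cat IHn.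
suff -> : parity (wpow w n) = false by rewrite addbF.
elim: n {IHn} => // n IHn.
rewrite /wpow /= -/(wpow _ n) /parity count_cat oddD -!/(parity _) IHn.
by rewrite (negPf pw).
Qed.

Definition abcd_word := [:: La; Lb; Lc; Ld].
Definition abcd := value Ggen abcd_word.

(** The section of abcdabcd at 1 is acdb, which equals abcd: a relation of even
exponent passes to half its exponent, and odd powers move the first level. *)
Lemma abcd_infinite_order n : 0 < n -> abcd ^+ n <> 1.
Proof.
elim/ltn_ind: n => n IHn n_gt0 Tn.
have n_even : ~~ odd n.
  move: Tn; rewrite -value_pow => /value_Ggen_eq1/trivial_actionP[].
  suff -> : parity (wpow abcd_word n) = odd n by [].
  elim: (n) => // m IHm.
  by rewrite /wpow /= -/(wpow _ m) /parity /= -/(parity _) IHm.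
have n2 : n = (2 * n./2)%N by rewrite mul2n even_halfK.
have [] := IHn n./2; [by lia | by lia | ].
move: Tn; rewrite {1}n2 expgnA expg2 -value_cat -value_pow.
move=> /value_Ggen_eq1/trivial_actionP[_ _].
rewrite section_at_wpow // => /value_Ggen_eq1; rewrite value_pow.
have -> : value Ggen (section_at true (abcd_word ++ abcd_word)) = abcd.
  exact: (value_eq_norm satisfies_basic_Ggen).
by [].
Qed.

Lemma dihedral_exp4 w : value Ggen (phi w) ^+ 4 = 1.
Proof.
have [y yD ->] := value_phi_dihedral satisfies_basic_Ggen w value_ac4.
have conj_ac4 t u : norm u = norm (t ++ wpow [:: La; Lc] 4 ++ rev t) ->
    value Ggen u = 1.
  move=> ut; rewrite -(value_nil Ggen).
  by apply: (value_eq_relator satisfies_basic_Ggen (t := t) value_ac4);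
    rewrite cats0.
have reduced1 u : norm u = [::] -> value Ggen u = 1.
  by rewrite -(value_norm satisfies_basic_Ggen) => ->; exact: value_nil.
rewrite -value_pow.
move: yD; rewrite !inE => yD; do ![case/predU1P: yD => [-> | yD]];
  rewrite ?(eqP yD); try by [apply: reduced1 | apply: (conj_ac4 [::])
                            | apply: (conj_ac4 [:: La])].
(* acac is the central involution of the dihedral group. *)
rewrite value_pow (expgnA _ 2 2) -value_pow.
by rewrite [value _ _](conj_ac4 [::]) // expg1n.
Qed.

(** The section of (abcd)^2k at 0 is the inverse of (abcd)^k, whereas that of an
element of the range of sigma is a value of phi and has finite order. *)
Lemma powers_avoid_range k : 0 < k -> ~ range sigma (abcd ^+ k).
Proof.
move=> k_gt0 [g _]; rewrite -[g]word_forK; move: (word_for g) => w.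
rewrite sigma_value => Tk.
pose abcd2 := abcd_word ++ abcd_word.
have : value Ggen (wpow abcd2 k) = value Ggen (subst (w ++ w)).
  by rewrite value_pow subst_cat !value_cat Tk -expgMn // expg2.
move/(value_section_at false); rewrite section_at_wpow //.
have [-> _] := section_at_subst (w ++ w); rewrite value_pow => Hk.
have : abcd ^+ (k * 4) = 1; last by apply: abcd_infinite_order; lia.
apply: invg_inj; rewrite invg1 -expVgn -(value_rev satisfies_basic_Ggen) expgnA.
have <- : value Ggen (section_at false abcd2) = value Ggen (rev abcd_word).
  exact: (value_eq_norm satisfies_basic_Ggen).
by rewrite Hk dihedral_exp4.
Qed.

Lemma infinite_index_sigma : infinite_index (range sigma).
Proof.
pose coset n := left_coset (abcd ^+ n) (range sigma).
have coset_lt n m : n < m -> coset n <> coset m.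
  move=> nm eq_nm; have : coset n (abcd ^+ m).
    rewrite eq_nm; exists 1; rewrite ?mulg1 //; exists 1 => //.
    by rewrite -(value_nil Ggen) sigma_value.
  case=> h sh; rewrite -(subnKC (ltnW nm)) expgnDr => /mulgI hT.
  by apply: (@powers_avoid_range (m - n)); rewrite ?subn_gt0 // -hT.
have coset_inj : injective coset.
  move=> n m eq_nm; case: (ltngtP n m) => // [/coset_lt[] // | /coset_lt[]].
  exact: esym.
move=> fin; apply: infinite_nat.
have : finite_set (range coset).
  by apply: sub_finite_set fin => _ [n _ <-]; exists (abcd ^+ n).
by rewrite (eq_finite_set (inj_card_eq (in2W coset_inj))).
Qed.

Lemma expanding_subst : expanding subst.
Proof.
have le w : size w <= size (subst w).
  elim: w => // l w IHw; rewrite -cat1s subst_cat !size_cat leq_add //.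
  by case: l.
split=> // w /splitPr[u v]; rewrite -cat1s !subst_cat !size_cat.
have := le u; have := le v.
by rewrite [size (subst [:: La])]/= [size [:: La]]/=; lia.
Qed.

Theorem proposition5p6 :
  is_presentation Ggen relators /\
  expanding subst /\
  exists f : {multiplicative Gtilde -> Gtilde},
    (forall w : seq letter, f (value Ggen w) = value Ggen (subst w)) /\
    injective f /\
    infinite_index (range f).
Proof.
split; first exact: presentation_Ggen.
split; first exact: expanding_subst.
exists sigma; split; first exact: sigma_value.
by split; [exact: sigma_inj | exact: infinite_index_sigma].
Qed.
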